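(* In a propositional language with any set (of any cardinality) of propositional variables, any set $X$ of consistent formulas with pairwise disjoint model sets is at most countable.
   Context: Classical two-valued propositional logic; the model set of a formula is the set of all assignments of truth values to the propositional variables which make the formula true. *)

(* Defs.v *)
From mathcomp Require Import all_boot.
From mathcomp Require Import boolp classical_sets cardinality.

Set Implicit Arguments.
Unset Strict Implicit.
Unset Printing Implicit Defensive.

Local Open Scope classical_set_scope.

Inductive formula (V : Type) : Type :=
| Var of V
| Top
| Bot
| Neg of formula V
| And of formula V & formula V
| Or of formula V & formula V
| Imp of formula V & formula V
| Iff of formula V & formula V.

Arguments Top {V}.
Arguments Bot {V}.

Definition assignment (V : Type) : Type := V -> bool.

Fixpoint eval (V : Type) (m : assignment V) (phi : formula V) : bool :=
  match phi with
  | Var p => m p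
  | Top => true
  | Bot => false
  | Neg a => ~~ eval m a
  | And a b => eval m a && eval m b
  | Or a b => eval m a || eval m b
  | Imp a b => eval m a ==> eval m b
  | Iff a b => eval m a == eval m b
  end.

Definition models (V : Type) (phi : formula V) : set (assignment V) :=
  [set m | eval m phi].

(* Semantic notion, no proof system is involved. *)
Definition consistent (V : Type) (phi : formula V) : Prop :=
  models phi !=set0.

(* Main.v *)
Require Import Defs.
From mathcomp Require Import all_boot.
From mathcomp Require Import boolp classical_sets cardinality.

Set Implicit Arguments.
Unset Strict Implicit.
Unset Printing Implicit Defensive.

Local Open Scope classical_set_scope.

(** A formula mentions finitely many variables, so a model of it remains a
    model whatever happens outside that finite set.  Two formulas with disjoint
    model sets therefore have clashing models: whichever models of them are
    chosen, these differ at a variable that both formulas mention, for otherwise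
    they could be glued into a common model ([disjoint_models_clash]).

    Among the finite partial assignments with fewer than [n] variables, a
    pairwise clashing family is finite ([clashing_family_finite]).  Hence [X]
    has, for every [n], finitely many members that mention fewer than [n]
    variables, and it is a countable union of finite sets. *)

Fixpoint vars (V : Type) (phi : formula V) : seq V :=
  match phi with
  | Var p => [:: p]
  | Top | Bot => [::]
  | Neg a => vars a
  | And a b | Or a b | Imp a b | Iff a b => vars a ++ vars b
  end.

Lemma eq_eval_vars (V : eqType) (phi : formula V) (m1 m2 : assignment V) :
  {in vars phi, m1 =1 m2} -> eval m1 phi = eval m2 phi.
Proof.
elim: phi => //= [p|a IHa|a IHa b IHb|a IHa b IHb|a IHa b IHb|a IHa b IHb] eqm.
- by apply: eqm; rewrite mem_seq1.
- by rewrite IHa.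
all: rewrite IHa ?IHb // => v v_in; apply: eqm; rewrite mem_cat v_in ?orbT //.
Qed.

(** If the two models agreed on all common variables, the assignment following
    [m1] on the variables of [phi] and [m2] elsewhere would satisfy both. *)
Lemma disjoint_models_clash (V : eqType) (phi psi : formula V)
    (m1 m2 : assignment V) :
  models phi `&` models psi = set0 -> models phi m1 -> models psi m2 ->
  exists v, [/\ v \in vars phi, v \in vars psi & m1 v != m2 v].
Proof.
move=> disj m1phi m2psi; apply: contrapT => no_clash.
pose m v := if v \in vars phi then m1 v else m2 v.
suff : (models phi `&` models psi) m by rewrite disj.
split; rewrite /models /=.
- by rewrite (eq_eval_vars (m2 := m1)) // => v v_phi; rewrite /m v_phi.
- rewrite (eq_eval_vars (m2 := m2)) // => v v_psi; rewrite /m.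
  case: ifP => // v_phi; apply/eqP/negPn/negP => clash.
  by apply: no_clash; exists v.
Qed.

(** Here [m i] restricted to [s i] is the partial assignment with index [i].
    Every member other than a fixed [i0] clashes with [i0] at one of the
    finitely many variables of [s i0].  Those that do so at [v] all take the
    value opposite to [m i0 v] there, so their mutual clashes lie elsewhere:
    they still clash after [v] is erased from their domains, and induction on
    the size of the domains applies. *)
Lemma clashing_family_finite (I : Type) (V : eqType)
    (m : I -> assignment V) (n : nat) (s : I -> seq V) (D : set I) :
  (forall i, D i -> size (s i) < n) ->
  (forall i j, D i -> D j -> i <> j ->
     exists v, [/\ v \in s i, v \in s j & m i v != m j v]) ->
  finite_set D.
Proof.
elim: n s D => [|n IHn] s D size_s clash.
  suff -> : D = set0 by exact: finite_set0.
  by apply/seteqP; split=> // i /size_s.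
have [->|/set0P[i0 Di0]] := eqVneq D set0; first exact: finite_set0.
pose D_ v := [set i | [/\ D i, v \in s i & m i v != m i0 v]].
apply: (@sub_finite_set _ _ ([set i0] `|` \bigcup_(v in [set` s i0]) D_ v)).
  move=> i Di; have [->|i_neq] := pselect (i = i0); first by left.
  by right; have [v [v_i v_i0 m_neq]] := clash i i0 Di Di0 i_neq; exists v.
rewrite finite_setU; split; first exact: finite_set1.
apply: bigcup_finite => [|v _]; first exact: finite_seq.
apply: (IHn (fun i => filter (predC1 v) (s i))) => [i [Di v_i _]|].
  apply: (@leq_trans (size (s i))); last exact: size_s.
  rewrite size_filter -(count_predC (pred1 v)).
  by rewrite -add1n leq_add2r -has_count has_pred1.
move=> i j [Di _ miv] [Dj _ mjv] i_neq_j.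
have [w [w_i w_j m_neq]] := clash i j Di Dj i_neq_j.
have w_neq_v : w != v.
  apply: contraNneq m_neq => ->.
  by case: (m i v) (m j v) (m i0 v) miv mjv => [] [] [].
by exists w; rewrite !mem_filter /= w_neq_v.
Qed.

Lemma disjoint_formulas_countable (V : eqType) (X : set (formula V)) :
  (forall phi, X phi -> consistent phi) -> trivIset X (@models V) ->
  countable X.
Proof.
move=> X_consistent X_disjoint.
have /choice[m mP] phi : exists m, X phi -> models phi m.
  have [/X_consistent[m phi_m]|nX] := pselect (X phi); first by exists m.
  by exists (fun=> true).
pose X_ n := X `&` [set phi | size (vars phi) < n].
have -> : X = \bigcup_n X_ n.
  apply/seteqP; split=> [phi Xphi|phi [n _ []] //].
  by exists (size (vars phi)).+1 => //; split=> //=.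
apply: bigcup_countable => // n _; apply: finite_set_countable.
apply: (clashing_family_finite (m := m) (n := n) (s := @vars V)) => [phi []//|].
move=> phi psi [Xphi _] [Xpsi _] neq.
apply: disjoint_models_clash (mP _ Xphi) (mP _ Xpsi).
by apply: contrapT => /eqP/set0P/X_disjoint; auto.
Qed.

Theorem fact2p2p3 (V : Type) (X : set (formula V))
  (X_consistent : forall phi, X phi -> consistent phi)
  (X_disjoint : trivIset X (@models V)) :
  countable X.
Proof.
(* Classically any type has the decidable equality that membership in [vars phi]
   relies on. *)
exact (@disjoint_formulas_countable {classic V} X X_consistent X_disjoint).
Qed.
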